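(* Let $[a,b]\subset[-1,1]$, $\alpha=\arccos(a)$, $\beta=\arccos(b)$, with $\alpha,\beta\in(0,\pi)$ and $\alpha>\beta$. Let $h$ be the step function on $[-1,1]$ with $h(x)=1$ for $x\in(a,b)$, $h(a)=h(b)=\tfrac12$ and $h(x)=0$ for $x\in[-1,1]\setminus[a,b]$; put $g(\theta)=h(\cos\theta)$ (so $g(\alpha)=g(\beta)=\tfrac12$), and let $q_d(\theta)=\frac{c_0}{2}+\sum_{j=1}^{d}\rho_{j,d}c_j\cos(j\theta)$ be its Chebyshev--Jackson trigonometric polynomial of degree $d$. Then for every integer $d\ge 2$, $$|q_d(\alpha)-g(\alpha)|\le\frac{\pi^6}{2(d+2)^3}\max\left\{\frac{1}{(2\pi-2\alpha)^4},\frac{1}{(\alpha-\beta)^4}\right\},$$ $$|q_d(\beta)-g(\beta)|\le\frac{\pi^6}{2(d+2)^3}\max\left\{\frac{1}{(2\beta)^4},\frac{1}{(\alpha-\beta)^4}\right\}.$$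
   Context: The Fourier coefficients are $c_0=\frac{2}{\pi}(\arccos(a)-\arccos(b))$ and $c_j=\frac{2}{\pi}\,\frac{\sin(j\arccos(a))-\sin(j\arccos(b))}{j}$ for $j=1,\dots,d$. The Jackson damping factors are $$\rho_{j,d}=\frac{(d+2-j)\sin(\frac{\pi}{d+2})\cos(\frac{j\pi}{d+2})+\cos(\frac{\pi}{d+2})\sin(\frac{j\pi}{d+2})}{(d+2)\sin\frac{\pi}{d+2}}.$$ *)

(* Defs.v *)
From Stdlib Require Import Reals.
From Coquelicot Require Import Coquelicot.
Open Scope R_scope.

(* Step function with midpoint values at its jumps. It is only meant on
   [-1, 1]; the value 0 outside that interval is a totalization. *)
Definition step (a b x : R) : R :=
  match Rlt_dec a x, Rlt_dec x b with
  | left _, left _ => 1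
  | _, _ =>
      if Req_dec_T x a then 1 / 2 else if Req_dec_T x b then 1 / 2 else 0
  end.

Definition step_angle (a b theta : R) : R := step a b (cos theta).

Definition fourier_coef (a b : R) (j : nat) : R :=
  match j with
  | O => 2 / PI * (acos a - acos b)
  | S _ =>
      2 / PI * ((sin (INR j * acos a) - sin (INR j * acos b)) / INR j)
  end.

Definition jackson_factor (d j : nat) : R :=
  let N := INR d + 2 in
  ((N - INR j) * sin (PI / N) * cos (INR j * PI / N)
   + cos (PI / N) * sin (INR j * PI / N))
  / (N * sin (PI / N)).

Definition chebyshev_jackson (a b : R) (d : nat) (theta : R) : R :=
  fourier_coef a b 0 / 2
  + sum_n_m
      (fun j => jackson_factor d j * fourier_coef a b j * cos (INR j * theta))
      1 d.

(* Main.v *)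
Require Import Defs.
From Stdlib Require Import Reals Lra Lia.
From Coquelicot Require Import Coquelicot.
Open Scope R_scope.

(** Write N = d + 2 and h = PI / N.  The polynomial q_d is the convolution of
    the even, 2 PI-periodic step function g with the Jackson kernel K, so with
    the odd primitive F of K,
      q_d(theta) = F(alpha + theta) - F(beta + theta)
                   + F(alpha - theta) - F(beta - theta).
    Three properties of F give the theorem.

    F is nondecreasing, i.e. K >= 0.  The coefficients of K satisfy a
    second-order recurrence in which multiplication by cos t - cos h collapses
    the cosine sum; doing it twice leaves
      (cos t - cos h)^2 K(t) = sin(h)^2 (1 + cos(N t)) / (2 PI N).

    F(0) = 0, F(PI) = 1/2 and F(2 PI - x) = 1 - F(x), from the Fourier series.
    With G = 1/2 - F, the mass of K on [x, PI], these symmetries and the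
    monotonicity turn the error at alpha into
      - G(alpha - beta) <= q_d(alpha) - 1/2 <= G(2 PI - 2 alpha),
    and similarly at beta with 2 beta as the upper argument.

    G(s) <= PI^6 / (2 N^3 s^4) for all s > 0.  For s <= 2 h the right-hand side
    exceeds 1/2 >= G(s), and for s >= PI it is positive while G(s) <= 0.  In
    between, the closed form bounds K by PI^5 / (N^3 s^4), because there
    cos h - cos s is at least (1 - cos s) / 2 >= (s / PI)^2; this is at most
    minus the derivative of the right-hand side as s <= 2 PI, so the bound
    propagates downwards from s = PI. *)

(** * Trigonometric sums *)

Lemma sum_n_m_1_0 (f : nat -> R) : sum_n_m f 1 0 = 0.
Proof. apply (sum_n_m_zero f); lia. Qed.

Lemma sum_n_m_1_S (f : nat -> R) (n : nat) :
  sum_n_m f 1 (S n) = sum_n_m f 1 n + f (S n).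
Proof. apply (sum_n_Sm f); lia. Qed.

Lemma sum_n_m_1_ext (f g : nat -> R) (n : nat) :
  (forall j, f j = g j) -> sum_n_m f 1 n = sum_n_m g 1 n.
Proof. apply (sum_n_m_ext f g). Qed.

Lemma sum_n_m_1_scal (c : R) (f : nat -> R) (n : nat) :
  sum_n_m (fun j => c * f j) 1 n = c * sum_n_m f 1 n.
Proof. apply (sum_n_m_mult_l (K := R_Ring)). Qed.

Lemma sin_pred_plus_sin_succ (x h : R) :
  sin (x - h) + sin (x + h) = 2 * cos h * sin x.
Proof. rewrite sin_minus, sin_plus; ring. Qed.

Lemma cos_pred_plus_cos_succ (x h : R) :
  cos (x - h) + cos (x + h) = 2 * cos h * cos x.
Proof. rewrite cos_minus, cos_plus; ring. Qed.

(** The Jackson factor of index [x] without its normalization [M * sin h], for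
    a real index and with [h] and [M] unrelated, so that the recurrence below is
    purely algebraic. *)
Definition jackson_numerator (M h x : R) : R :=
  (M - x) * sin h * cos (x * h) + cos h * sin (x * h).

(** Both [cos (x * h)] and [sin (x * h)] are annihilated by the operator
    u(x - 1) + u(x + 1) - 2 cos h u(x); only the linear factor [M - x]
    contributes, and it leaves a pure sine. *)
Lemma jackson_numerator_recurrence (M h x : R) :
  jackson_numerator M h (x - 1) + jackson_numerator M h (x + 1)
  = 2 * cos h * jackson_numerator M h x + 2 * sin h ^ 2 * sin (x * h).
Proof.
  unfold jackson_numerator.
  replace ((x - 1) * h) with (x * h - h) by ring.
  replace ((x + 1) * h) with (x * h + h) by ring.
  rewrite sin_minus, sin_plus, cos_minus, cos_plus; ring.
Qed.

(** Since 2 cos t cos(jt) = cos((j-1)t) + cos((j+1)t), multiplying a cosine sum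
    by 2 (cos t - cos h) applies the operator of the recurrence to its
    coefficients: the numerators become sines, up to two boundary terms at the
    truncation index. *)
Lemma kernel_times_first_factor (M h t : R) (n : nat) :
  (cos t - cos h)
  * (jackson_numerator M h 0
     + 2 * sum_n_m (fun j => jackson_numerator M h (INR j) * cos (INR j * t)) 1 n)
  = 2 * sin h ^ 2 * sum_n_m (fun j => sin (INR j * h) * cos (INR j * t)) 1 n
    + jackson_numerator M h (INR n) * cos ((INR n + 1) * t)
    - jackson_numerator M h (INR n + 1) * cos (INR n * t).
Proof.
  induction n as [|n IH].
  - rewrite !sum_n_m_1_0. simpl INR. unfold jackson_numerator.
    rewrite !Rplus_0_l, !Rmult_0_l, !Rmult_1_l, cos_0, sin_0. ring.
  - rewrite !sum_n_m_1_S.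
    rewrite (Rmult_plus_distr_l 2), <- (Rplus_assoc (jackson_numerator M h 0)),
      (Rmult_plus_distr_l (cos t - cos h)), IH.
    pose proof (jackson_numerator_recurrence M h (INR (S n))) as Hr.
    pose proof (cos_pred_plus_cos_succ (INR (S n) * t) t) as Hc.
    replace (INR (S n) * t - t) with (INR n * t) in Hc by (rewrite S_INR; ring).
    replace (INR (S n) * t + t) with ((INR (S n) + 1) * t) in Hc by ring.
    replace (INR (S n) - 1) with (INR n) in Hr by (rewrite S_INR; ring).
    replace (INR n + 1) with (INR (S n)) by apply S_INR.
    apply Rminus_diag_uniq.
    match type of Hr with ?a + ?b = ?c => assert (Hr' : b = c - a) by lra end.
    match type of Hc with ?a + ?b = ?c => assert (Hc' : b = c - a) by lra end.
    rewrite Hr', Hc'. ring.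
Qed.

(** The sines lie in the kernel of the operator, so the second multiplication
    leaves boundary terms only. *)
Lemma sine_sum_times_second_factor (h t : R) (n : nat) :
  2 * (cos t - cos h) * sum_n_m (fun j => sin (INR j * h) * cos (INR j * t)) 1 n
  = sin h + sin (INR n * h) * cos ((INR n + 1) * t)
    - sin ((INR n + 1) * h) * cos (INR n * t).
Proof.
  induction n as [|n IH].
  - rewrite sum_n_m_1_0. simpl INR.
    rewrite Rplus_0_l, !Rmult_0_l, !Rmult_1_l, cos_0, sin_0. ring.
  - rewrite sum_n_m_1_S, Rmult_plus_distr_l, IH.
    pose proof (sin_pred_plus_sin_succ (INR (S n) * h) h) as Hs.
    pose proof (cos_pred_plus_cos_succ (INR (S n) * t) t) as Hc.
    replace (INR (S n) * t - t) with (INR n * t) in Hc by (rewrite S_INR; ring).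
    replace (INR (S n) * t + t) with ((INR (S n) + 1) * t) in Hc by ring.
    replace (INR (S n) * h - h) with (INR n * h) in Hs by (rewrite S_INR; ring).
    replace (INR (S n) * h + h) with ((INR (S n) + 1) * h) in Hs by ring.
    replace (INR n + 1) with (INR (S n)) by apply S_INR.
    match type of Hs with ?a + ?b = ?c => assert (Hs' : b = c - a) by lra end.
    match type of Hc with ?a + ?b = ?c => assert (Hc' : b = c - a) by lra end.
    rewrite Hs', Hc'. ring.
Qed.

(** * The Jackson kernel and its primitive *)

(** Normalized to have integral 1 over a period. *)
Definition jackson_kernel (d : nat) (t : R) : R :=
  / (2 * PI)
  * (1 + 2 * sum_n_m (fun j => jackson_factor d j * cos (INR j * t)) 1 d).

Definition jackson_primitive (d : nat) (x : R) : R :=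
  x / (2 * PI)
  + / PI * sum_n_m (fun j => jackson_factor d j * (sin (INR j * x) / INR j)) 1 d.

Lemma jackson_mesh_bounds (d : nat) :
  0 < INR d + 2 /\ 0 < PI / (INR d + 2) <= PI / 2.
Proof.
  pose proof PI_RGT_0. pose proof (pos_INR d).
  split; [lra|split].
  - apply Rdiv_lt_0_compat; lra.
  - apply Rmult_le_compat_l; [lra|]. apply Rinv_le_contravar; lra.
Qed.

Lemma sin_mesh_pos (d : nat) : 0 < sin (PI / (INR d + 2)).
Proof.
  pose proof PI_RGT_0. destruct (jackson_mesh_bounds d) as [_ H1].
  apply sin_gt_0; lra.
Qed.

(** Away from its zeros the factor [cos t - cos (PI / N)] can be divided out, so
    this identity determines the kernel, exhibits its sign and gives its decay
    of order 1 / N^3. *)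
Lemma jackson_kernel_closed_form (d : nat) (t : R) :
  let N := INR d + 2 in
  (cos t - cos (PI / N)) ^ 2 * jackson_kernel d t
  = sin (PI / N) ^ 2 * (1 + cos (N * t)) / (2 * PI * N).
Proof.
  intros N. pose proof PI_RGT_0 as Hpi.
  destruct (jackson_mesh_bounds d) as [HN Hh]. pose proof (sin_mesh_pos d) as Hs.
  fold N in HN, Hh, Hs. set (h := PI / N) in *.
  assert (HNh : N * h = PI) by (unfold h; field; lra).
  assert (HN1 : N - 1 = INR (S d)) by (unfold N; rewrite S_INR; ring).
  assert (Hlast : jackson_numerator N h (INR (S d)) = 0).
  { rewrite <- HN1. unfold jackson_numerator.
    replace ((N - 1) * h) with (PI - h) by lra.
    rewrite sin_minus, cos_minus, sin_PI, cos_PI. ring. }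
  assert (Hlast' : jackson_numerator N h (INR (S d) + 1) = 0).
  { replace (INR (S d) + 1) with N by lra. unfold jackson_numerator.
    rewrite HNh, sin_PI. ring. }
  assert (H0 : jackson_numerator N h 0 = N * sin h).
  { unfold jackson_numerator. rewrite Rmult_0_l, sin_0, cos_0. ring. }
  (* The sums are taken up to d + 1 = N - 1: the numerators of index N - 1 and N
     vanish, which removes the boundary terms without changing the first sum. *)
  pose proof (kernel_times_first_factor N h t (S d)) as E1.
  pose proof (sine_sum_times_second_factor h t (S d)) as E2.
  rewrite (sum_n_m_1_S (fun j => jackson_numerator N h (INR j) * cos (INR j * t))),
    Hlast, Hlast', H0 in E1.
  replace (INR (S d) + 1) with N in E2 by lra.
  rewrite <- HN1, HNh, sin_PI in E2.
  replace ((N - 1) * h) with (PI - h) in E2 by lra.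
  rewrite !Rtrigo_facts.sin_pi_minus in E2.
  assert (HK : jackson_kernel d t
    = / (2 * PI) * / (N * sin h) * (N * sin h + 2 *
        sum_n_m (fun j => jackson_numerator N h (INR j) * cos (INR j * t)) 1 d)).
  { unfold jackson_kernel.
    rewrite (sum_n_m_1_ext _ (fun j => / (N * sin h)
       * (jackson_numerator N h (INR j) * cos (INR j * t)))).
    - rewrite sum_n_m_1_scal. field; lra.
    - intros j. unfold jackson_factor, jackson_numerator. cbv zeta.
      fold N. fold h. replace (INR j * PI / N) with (INR j * h) by (unfold h; field; lra).
      field; lra. }
  rewrite HK.
  set (A := sum_n_m _ 1 d) in *. set (B := sum_n_m _ 1 (S d)) in *.
  replace ((cos t - cos h) ^ 2 * (/ (2 * PI) * / (N * sin h) * (N * sin h + 2 * A)))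
    with (/ (2 * PI) * / (N * sin h) * (cos t - cos h)
          * ((cos t - cos h) * (N * sin h + 2 * (A + 0 * cos (INR (S d) * t)))))
    by (simpl; ring).
  rewrite E1.
  transitivity (/ (2 * PI) * / (N * sin h) * sin h ^ 2
                * (2 * (cos t - cos h) * B)); [ring|].
  rewrite E2. field; lra.
Qed.

Lemma is_derive_sum_from_1 (f df : nat -> R -> R) (n : nat) (x : R) :
  (forall j, (1 <= j)%nat -> is_derive (f j) x (df j x)) ->
  is_derive (fun y => sum_n_m (fun j => f j y) 1 n) x
    (sum_n_m (fun j => df j x) 1 n).
Proof.
  intros Hf. induction n as [|n IH].
  - apply (is_derive_ext (fun _ => 0)).
    + intros y. symmetry. apply sum_n_m_1_0.
    + rewrite sum_n_m_1_0. apply (is_derive_const (V := R_NormedModule)).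
  - apply (is_derive_ext (fun y => sum_n_m (fun j => f j y) 1 n + f (S n) y)).
    + intros y. symmetry. apply (sum_n_m_1_S (fun j => f j y)).
    + rewrite sum_n_m_1_S. apply (is_derive_plus (V := R_NormedModule)); [exact IH|].
      apply Hf; lia.
Qed.

Lemma is_derive_jackson_primitive (d : nat) (x : R) :
  is_derive (jackson_primitive d) x (jackson_kernel d x).
Proof.
  pose proof PI_RGT_0.
  pose proof (is_derive_sum_from_1
    (fun j y => jackson_factor d j * (sin (INR j * y) / INR j))
    (fun j y => jackson_factor d j * cos (INR j * y)) d x) as Hsum.
  unfold jackson_primitive, jackson_kernel.
  set (D := sum_n_m _ 1 d) in *.
  replace (/ (2 * PI) * (1 + 2 * D)) with (/ (2 * PI) + / PI * D) by (field; lra).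
  apply (is_derive_plus (V := R_NormedModule)).
  - auto_derive; [trivial|field; lra].
  - apply (is_derive_scal _ x (/ PI)). apply Hsum.
    intros j Hj. apply le_INR in Hj; simpl in Hj.
    auto_derive; [trivial|field; lra].
Qed.

Lemma ex_derive_jackson_kernel (d : nat) (x : R) :
  ex_derive (jackson_kernel d) x.
Proof.
  unfold jackson_kernel.
  pose proof (is_derive_sum_from_1
    (fun j y => jackson_factor d j * cos (INR j * y))
    (fun j y => jackson_factor d j * (- (INR j) * sin (INR j * y))) d x) as Hsum.
  eexists. apply (is_derive_scal _ x (/ (2 * PI))).
  apply (is_derive_plus (V := R_NormedModule)); [apply (is_derive_const (V := R_NormedModule))|].
  apply (is_derive_scal _ x 2). apply Hsum.
  intros j _. auto_derive; [trivial|ring].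
Qed.

(** The closed form gives the sign except where [cos t = cos (PI / N)].  If the
    kernel were negative at such a point, it would be so on a neighbourhood, on
    which cos would then be constant; that forces sin t = 0, whereas
    cos (PI / N) is not 1 or -1. *)
Lemma jackson_kernel_ge0 (d : nat) (t : R) : 0 <= jackson_kernel d t.
Proof.
  destruct (Rle_or_lt 0 (jackson_kernel d t)) as [|Hneg]; [assumption|exfalso].
  pose proof PI_RGT_0 as Hpi.
  destruct (jackson_mesh_bounds d) as [HN Hh]. pose proof (sin_mesh_pos d) as Hs.
  assert (Hzero : forall y, jackson_kernel d y < 0 -> cos y = cos (PI / (INR d + 2))).
  { intros y Hy. pose proof (jackson_kernel_closed_form d y) as E. cbv zeta in E.
    assert (Hrhs : 0 <= sin (PI / (INR d + 2)) ^ 2 * (1 + cos ((INR d + 2) * y))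
                        / (2 * PI * (INR d + 2))).
    { pose proof (COS_bound ((INR d + 2) * y)).
      apply Rdiv_le_0_compat; [apply Rmult_le_pos; [apply pow2_ge_0|lra]|].
      apply Rmult_lt_0_compat; lra. }
    rewrite <- E in Hrhs.
    destruct (Req_dec (cos y - cos (PI / (INR d + 2))) 0) as [|Hne]; [lra|].
    pose proof (pow2_gt_0 _ Hne). nra. }
  assert (Hloc : locally t (fun y => jackson_kernel d y < 0)).
  { pose proof (ex_derive_continuous (jackson_kernel d) t (ex_derive_jackson_kernel d t))
      as Hcont.
    exact (Hcont (fun z => z < 0) (open_lt 0 (jackson_kernel d t) Hneg)). }
  assert (Hd : is_derive cos t 0).
  { apply (is_derive_ext_loc (fun _ => cos (PI / (INR d + 2)))).
    - revert Hloc. apply filter_imp. intros y Hy. symmetry. now apply Hzero.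
    - apply (is_derive_const (V := R_NormedModule)). }
  assert (Hsin : sin t = 0).
  { apply is_derive_unique in Hd. rewrite (is_derive_unique cos t (- sin t)) in Hd.
    - lra.
    - auto_derive; [trivial|ring]. }
  pose proof (Hzero t Hneg) as Hc.
  pose proof (sin2_cos2 t) as T1. pose proof (sin2_cos2 (PI / (INR d + 2))) as T2.
  unfold Rsqr in *. rewrite Hsin, Hc in T1. nra.
Qed.

Lemma jackson_primitive_incr (d : nat) (x y : R) :
  x <= y -> jackson_primitive d x <= jackson_primitive d y.
Proof.
  intros Hxy.
  destruct (MVT_gen (jackson_primitive d) x y (jackson_kernel d)) as [c [_ Hc]].
  - intros; apply is_derive_jackson_primitive.
  - intros z _. apply continuity_pt_filterlim.
    apply (ex_derive_continuous (jackson_primitive d)).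
    eexists; apply is_derive_jackson_primitive.
  - pose proof (jackson_kernel_ge0 d c). nra.
Qed.

Lemma jackson_primitive_PI (d : nat) : jackson_primitive d PI = 1 / 2.
Proof.
  pose proof PI_RGT_0. unfold jackson_primitive.
  rewrite (sum_n_m_1_ext _ (fun _ => 0)).
  - rewrite (sum_n_m_const_zero (G := R_AbelianMonoid)). unfold zero; simpl. field; lra.
  - intros j.
    rewrite (sin_eq_0_1 (INR j * PI)).
    + unfold Rdiv; ring.
    + exists (Z.of_nat j). now rewrite <- INR_IZR_INZ.
Qed.

(** Every term sin(jx)/j is odd and 2 PI-periodic, and the linear part gains
    [k].  The case [k = 0] is oddness, the case [k = 1] the symmetry of the
    kernel about PI. *)
Lemma jackson_primitive_reflect (d k : nat) (x : R) :
  jackson_primitive d (2 * INR k * PI - x) = INR k - jackson_primitive d x.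
Proof.
  pose proof PI_RGT_0. unfold jackson_primitive.
  rewrite (sum_n_m_1_ext _
    (fun j => -1 * (jackson_factor d j * (sin (INR j * x) / INR j)))).
  - rewrite sum_n_m_1_scal. field; lra.
  - intros j.
    replace (INR j * (2 * INR k * PI - x))
      with (- (INR j * x) + 2 * INR (j * k) * PI) by (rewrite mult_INR; ring).
    rewrite sin_period, sin_neg. unfold Rdiv; ring.
Qed.

Lemma jackson_primitive_0 (d : nat) : jackson_primitive d 0 = 0.
Proof.
  pose proof (jackson_primitive_reflect d 0 0) as E. simpl in E.
  replace (2 * 0 * PI - 0) with 0 in E by ring. lra.
Qed.

(** The convolution of the kernel with the indicator of [beta, alpha] and its
    mirror image [-alpha, -beta]; term by term it is the product formula for
    2 sin(jy) cos(j theta). *)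
Lemma chebyshev_jackson_as_primitive (a b : R) (d : nat) (theta : R) :
  chebyshev_jackson a b d theta
  = jackson_primitive d (acos a + theta) - jackson_primitive d (acos b + theta)
    + (jackson_primitive d (acos a - theta) - jackson_primitive d (acos b - theta)).
Proof.
  pose proof PI_RGT_0. unfold chebyshev_jackson, jackson_primitive.
  set (T := fun y => sum_n_m (fun j => jackson_factor d j * (sin (INR j * y) / INR j)) 1 d).
  fold (T (acos a + theta)) (T (acos b + theta)) (T (acos a - theta)) (T (acos b - theta)).
  assert (E : @eq R
    (sum_n_m (fun j => jackson_factor d j * fourier_coef a b j
                       * cos (INR j * theta)) 1 d)
    (/ PI * (T (acos a + theta) - T (acos b + theta)
             + (T (acos a - theta) - T (acos b - theta))))).
  { unfold T. clear T. generalize (jackson_factor d) as rho; intros rho.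
    induction d as [|n IH].
    - rewrite !sum_n_m_1_0. ring.
    - rewrite !sum_n_m_1_S, IH. unfold fourier_coef.
      rewrite !Rmult_plus_distr_l, !Rmult_minus_distr_l.
      rewrite !sin_plus, !sin_minus. field.
      split; [|lra]. apply not_0_INR; lia. }
  rewrite E. unfold fourier_coef. field; lra.
Qed.

(** * The mass of the kernel away from the origin *)

(** Jordan's inequality, by concavity: if the graph went below its chord at
    [u], the mean slopes of sin on [0, u] and [u, PI/2] would increase, while
    cos decreases. *)
Lemma jordan_sin (u : R) : 0 <= u <= PI / 2 -> 2 / PI * u <= sin u.
Proof.
  intros [H0 H1]. pose proof PI_RGT_0 as Hpi.
  destruct (Req_dec u 0) as [->|Hu0]; [rewrite sin_0; lra|].
  destruct (Req_dec u (PI / 2)) as [->|Hu1].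
  { rewrite sin_PI2. apply Req_le. field; lra. }
  destruct (Rle_or_lt (2 / PI * u) (sin u)) as [|Hlt]; [assumption|exfalso].
  destruct (MVT_cor2 sin cos 0 u) as [c1 [E1 B1]];
    [lra|intros; apply derivable_pt_lim_sin|].
  destruct (MVT_cor2 sin cos u (PI / 2)) as [c2 [E2 B2]];
    [lra|intros; apply derivable_pt_lim_sin|].
  rewrite sin_0 in E1. rewrite sin_PI2 in E2.
  assert (Hc : cos c2 <= cos c1) by (apply cos_decr_1; lra).
  assert (Hone : 2 / PI * (PI / 2) = 1) by (field; lra).
  assert (cos c1 < 2 / PI) by nra.
  assert (2 / PI < cos c2) by nra.
  lra.
Qed.

Lemma one_minus_cos_lower (s : R) :
  0 <= s <= PI -> 2 * (s / PI) ^ 2 <= 1 - cos s.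
Proof.
  intros Hs. pose proof PI_RGT_0.
  pose proof (jordan_sin (s / 2) ltac:(lra)) as J.
  replace (2 / PI * (s / 2)) with (s / PI) in J by (field; lra).
  assert (0 <= s / PI) by (apply Rdiv_le_0_compat; lra).
  replace (cos s) with (1 - 2 * sin (s / 2) * sin (s / 2))
    by (rewrite <- cos_2a_sin; f_equal; field).
  nra.
Qed.

(** From twice the first zero [h = PI / N] of the factor on, that factor is
    comparable to its value for [h = 0]: with c = cos h one has
    cos s <= cos (2 h) = 2 c^2 - 1 <= 2 c - 1, that is
    c - cos s >= (1 - cos s) / 2. *)
Lemma jackson_kernel_upper (d : nat) (s : R) :
  let N := INR d + 2 in
  2 * PI / N <= s <= PI ->
  jackson_kernel d s <= PI ^ 5 / (N ^ 3 * s ^ 4).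
Proof.
  intros N [Hs1 Hs2]. pose proof PI_RGT_0 as Hpi.
  destruct (jackson_mesh_bounds d) as [HN Hh]. pose proof (sin_mesh_pos d) as Hsin.
  pose proof (jackson_kernel_closed_form d s) as E. pose proof (jackson_kernel_ge0 d s) as K0.
  cbv zeta in E. fold N in HN, Hh, Hsin, E.
  replace (2 * PI / N) with (2 * (PI / N)) in Hs1 by (field; lra).
  set (h := PI / N) in *. set (K := jackson_kernel d s) in *.
  assert (Hcos : cos s <= cos (2 * h)) by (apply cos_decr_1; lra).
  rewrite cos_2a_cos in Hcos.
  assert (Hc0 : 0 <= cos h) by (apply cos_ge_0; lra).
  pose proof (COS_bound h) as [_ Hc1].
  assert (Hgap : (s / PI) ^ 2 <= cos h - cos s).
  { pose proof (one_minus_cos_lower s ltac:(lra)). nra. }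
  assert (Hq : 0 < (s / PI) ^ 2).
  { apply pow_lt. apply Rdiv_lt_0_compat; lra. }
  assert (Hgap2 : (s / PI) ^ 4 <= (cos s - cos h) ^ 2) by nra.
  assert (Hsh : sin h ^ 2 <= h ^ 2).
  { apply pow_incr. split; [lra|]. left; apply sin_lt_x; lra. }
  assert (Hnum : sin h ^ 2 * (1 + cos (N * s)) / (2 * PI * N) <= h ^ 2 * 2 / (2 * PI * N)).
  { apply Rmult_le_compat_r.
    - left; apply Rinv_0_lt_compat. apply Rmult_lt_0_compat; lra.
    - pose proof (COS_bound (N * s)). apply Rmult_le_compat; try lra.
      apply pow2_ge_0. }
  assert (HKq : (s / PI) ^ 4 * K <= h ^ 2 * 2 / (2 * PI * N)).
  { rewrite <- E in Hnum. apply Rle_trans with (2 := Hnum).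
    apply Rmult_le_compat_r; assumption. }
  assert (Hq4 : 0 < (s / PI) ^ 4) by (apply pow_lt, Rdiv_lt_0_compat; lra).
  apply (Rmult_le_reg_l _ _ _ Hq4). apply Rle_trans with (1 := HKq).
  apply Req_le. unfold h. field. repeat split; lra.
Qed.

(** [1 / 2 - jackson_primitive d s] is the integral of the kernel over [s, PI]
    (signed when [s > PI]). *)
Lemma jackson_tail_bound (d : nat) (s : R) :
  let N := INR d + 2 in
  (2 <= d)%nat -> 0 < s ->
  1 / 2 - jackson_primitive d s <= PI ^ 6 / (2 * N ^ 3) * (1 / s ^ 4).
Proof.
  intros N Hd Hs. pose proof PI_RGT_0 as Hpi.
  assert (HN : 4 <= N) by (unfold N; apply le_INR in Hd; simpl in Hd; lra).
  assert (Hbound : forall x, 0 < x -> 0 < PI ^ 6 / (2 * N ^ 3) * (1 / x ^ 4)).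
  { intros x Hx. repeat (lra || apply Rmult_lt_0_compat || apply Rinv_0_lt_compat
        || apply pow_lt). }
  destruct (Rle_or_lt PI s) as [Hlarge|Hsmall].
  { pose proof (jackson_primitive_incr d PI s Hlarge).
    rewrite jackson_primitive_PI in *. specialize (Hbound s Hs). lra. }
  destruct (Rle_or_lt s (2 * PI / N)) as [Hnear|Hfar].
  - assert (H0 : jackson_primitive d 0 <= jackson_primitive d s)
      by (apply jackson_primitive_incr; lra).
    rewrite jackson_primitive_0 in H0.
    assert (H4 : 1 / (2 * PI / N) ^ 4 <= 1 / s ^ 4).
    { apply Rmult_le_compat_l; [lra|]. apply Rinv_le_contravar; [now apply pow_lt|].
      apply pow_incr; lra. }
    assert (Hval : PI ^ 6 / (2 * N ^ 3) * (1 / (2 * PI / N) ^ 4) = PI ^ 2 * N / 32)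
      by (field; lra).
    (* With N >= 4 and PI > 3 the value at 2 PI / N is at least 9/8. *)
    pose proof PI2_3_2.
    assert (1 / 2 <= PI ^ 2 * N / 32) by nra.
    assert (PI ^ 6 / (2 * N ^ 3) * (1 / (2 * PI / N) ^ 4)
            <= PI ^ 6 / (2 * N ^ 3) * (1 / s ^ 4)).
    { apply Rmult_le_compat_l; [|exact H4].
      apply Rdiv_le_0_compat; [apply pow_le; lra|].
      apply Rmult_lt_0_compat; [lra|apply pow_lt; lra]. }
    lra.
  - set (C := PI ^ 6 / (2 * N ^ 3)) in *.
    (* Phi decreases on [s, PI], and Phi PI >= 1 / 2. *)
    set (Phi := fun x => jackson_primitive d x + C * (1 / x ^ 4)).
    assert (HPhi : forall x, s <= x ->
      is_derive Phi x (jackson_kernel d x + C * (- 4 / x ^ 5))).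
    { intros x Hx. apply (is_derive_plus (V := R_NormedModule)).
      - apply is_derive_jackson_primitive.
      - auto_derive; [apply Rgt_not_eq; repeat (lra || apply Rmult_lt_0_compat)|field; lra]. }
    destruct (MVT_gen Phi s PI (fun x => jackson_kernel d x + C * (- 4 / x ^ 5)))
      as [c [Bc Ec]].
    + intros x Hx. rewrite Rmin_left in Hx by lra. apply HPhi; lra.
    + intros x Hx. rewrite Rmin_left in Hx by lra.
      apply continuity_pt_filterlim. apply (ex_derive_continuous Phi).
      eexists; apply HPhi; lra.
    + rewrite Rmin_left, Rmax_right in Bc by lra.
      pose proof (jackson_kernel_upper d c ltac:(fold N; lra)) as HK.
      cbv zeta in HK; fold N in HK.
      assert (Hslope : PI ^ 5 / (N ^ 3 * c ^ 4) <= C * (4 / c ^ 5)).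
      { replace (C * (4 / c ^ 5)) with (PI ^ 5 / (N ^ 3 * c ^ 4) * (2 * PI / c))
          by (unfold C; field; lra).
        assert (0 < PI ^ 5 / (N ^ 3 * c ^ 4)).
        { repeat (lra || apply Rmult_lt_0_compat || apply Rinv_0_lt_compat
        || apply pow_lt). }
        assert (1 <= 2 * PI / c).
        { apply (Rmult_le_reg_r c); [lra|]. unfold Rdiv.
          rewrite Rmult_assoc, Rinv_l; lra. }
        nra. }
      replace (- 4 / c ^ 5) with (- (4 / c ^ 5)) in Ec by (field; lra).
      assert (Hdec : Phi PI <= Phi s) by nra.
      unfold Phi in Hdec. rewrite jackson_primitive_PI in Hdec.
      specialize (Hbound PI Hpi). lra.
Qed.

(** * The error at the jumps *)

Lemma step_left (a b : R) : step a b a = 1 / 2.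
Proof.
  unfold step. destruct (Rlt_dec a a) as [H|_]; [lra|].
  destruct (Req_dec_T a a); [reflexivity|contradiction].
Qed.

Lemma step_right (a b : R) : step a b b = 1 / 2.
Proof.
  unfold step. destruct (Rlt_dec b b) as [H|_]; [lra|].
  destruct (Rlt_dec a b); destruct (Req_dec_T b a);
    destruct (Req_dec_T b b); reflexivity || contradiction.
Qed.

Theorem theorem3p3 :
  forall (a b alpha beta : R) (d : nat),
    -1 <= a -> a <= b -> b <= 1 ->
    alpha = acos a -> beta = acos b ->
    0 < alpha < PI -> 0 < beta < PI -> alpha > beta ->
    (2 <= d)%nat ->
    Rabs (chebyshev_jackson a b d alpha - step_angle a b alpha)
      <= PI ^ 6 / (2 * (INR d + 2) ^ 3)
         * Rmax (1 / (2 * PI - 2 * alpha) ^ 4) (1 / (alpha - beta) ^ 4)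
    /\
    Rabs (chebyshev_jackson a b d beta - step_angle a b beta)
      <= PI ^ 6 / (2 * (INR d + 2) ^ 3)
         * Rmax (1 / (2 * beta) ^ 4) (1 / (alpha - beta) ^ 4).
Proof.
  intros a b alpha beta d Ha Hab Hb Ealpha Ebeta Halpha Hbeta Hlt Hd.
  pose proof PI_RGT_0 as Hpi.
  set (C := PI ^ 6 / (2 * (INR d + 2) ^ 3)).
  assert (HC : 0 <= C).
  { unfold C. pose proof (pos_INR d). apply Rdiv_le_0_compat; [apply pow_le; lra|].
    apply Rmult_lt_0_compat; [lra|apply pow_lt; lra]. }
  set (F := jackson_primitive d).
  assert (Hincr : forall x y, x <= y -> F x <= F y) by apply jackson_primitive_incr.
  assert (Hodd : forall x, F (- x) = - F x).
  { intros x. pose proof (jackson_primitive_reflect d 0 x) as E. simpl in E.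
    replace (2 * 0 * PI - x) with (- x) in E by ring. unfold F; lra. }
  assert (Hrefl : forall x, F (2 * PI - x) = 1 - F x).
  { intros x. pose proof (jackson_primitive_reflect d 1 x) as E. simpl in E.
    replace (2 * 1 * PI - x) with (2 * PI - x) in E by ring. exact E. }
  assert (F0 : F 0 = 0) by apply jackson_primitive_0.
  assert (Htail : forall x, 0 < x -> 1 / 2 - F x <= C * (1 / x ^ 4))
    by (intros; now apply jackson_tail_bound).
  (* The lower end of the error is a tail at y, the upper end a tail at x. *)
  assert (Hmax : forall x y e, 0 < x -> 0 < y ->
    - (1 / 2 - F y) <= e <= 1 / 2 - F x ->
    Rabs e <= C * Rmax (1 / x ^ 4) (1 / y ^ 4)).
  { intros x y e Hx Hy He. specialize (Htail x Hx) as Tx. specialize (Htail y Hy) as Ty.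
    pose proof (Rmult_le_compat_l C _ _ HC (Rmax_l (1 / x ^ 4) (1 / y ^ 4))).
    pose proof (Rmult_le_compat_l C _ _ HC (Rmax_r (1 / x ^ 4) (1 / y ^ 4))).
    apply Rabs_le; lra. }
  assert (Hneg : F (beta - alpha) = - F (alpha - beta))
    by (rewrite <- Hodd; f_equal; ring).
  split.
  - assert (Estep : step_angle a b alpha = 1 / 2).
    { unfold step_angle. rewrite Ealpha, cos_acos by lra. apply step_left. }
    rewrite Estep, chebyshev_jackson_as_primitive, <- Ealpha, <- Ebeta. fold F.
    rewrite Rminus_diag, F0, Hneg.
    apply Hmax; [lra|lra|]. rewrite Hrefl.
    replace (alpha + alpha) with (2 * alpha) by ring.
    (* The error is - G(alpha - beta) + F(2 alpha) - F(alpha + beta). *)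
    pose proof (Hincr (alpha - beta) (beta + alpha) ltac:(lra)).
    pose proof (Hincr (beta + alpha) (2 * alpha) ltac:(lra)).
    lra.
  - assert (Estep : step_angle a b beta = 1 / 2).
    { unfold step_angle. rewrite Ebeta, cos_acos by lra. apply step_right. }
    rewrite Estep, chebyshev_jackson_as_primitive, <- Ealpha, <- Ebeta. fold F.
    rewrite Rminus_diag, F0.
    apply Hmax; [lra|lra|].
    replace (beta + beta) with (2 * beta) by ring.
    (* The error is - G(alpha - beta) + F(alpha + beta) - F(2 beta); for the
       upper bound alpha + beta, possibly beyond PI, is folded back about PI. *)
    pose proof (Hincr (2 * beta) (alpha + beta) ltac:(lra)).
    pose proof (Hincr (alpha - beta) (2 * PI - (alpha + beta)) ltac:(lra)) as Hfold.
    rewrite Hrefl in Hfold.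
    lra.
Qed.
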